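(* Let $M$ be a connected $C^\infty$ manifold without boundary endowed with a complete Riemannian metric, let $H:T^*M\to\mathbb{R}$ be a $C^2$ function which is uniformly superlinear, uniformly bounded and $C^2$-strictly convex in the fibers, and let $G$ be a group acting on $M$ by diffeomorphisms preserving $H$. If $G$ is an amenable (discrete) group, then $c_{G,min}(H)=c(H)$.
   Context: $\|\cdot\|$ denotes the norm on $T_xM$ given by the Riemannian metric and also the dual norm on $T^*_xM$. Conditions on $H$: - Uniform superlinearity: for every $K\ge 0$ there exists $C^*(K)\in\mathbb{R}$ such that $H(x,p)\ge K\|p\|-C^*(K)$ for all $(x,p)\in T^*M$. - Uniform boundedness: for every $R\ge 0$, $\sup\{H(x,p)\mid \|p\|\le R\}<+\infty$. - $C^2$-strict convexity in the fibers: for every $(x,p)\in T^*M$, $\partial^2H/\partial p^2(x,p)$ is positive definite. $G$ preserves $H$: for all $g\in G$, $x\in M$, $p\in T^*_{g(x)}M$, $H(g(x),p)=H(x,p\circ d_xg)$. Lagrangian: $L(x,v)=\max_{p\in T^*_xM}\langle p,v\rangle-H(x,p)$ on $TM$. For $c\in\mathbb{R}$, $\mathcal{H}(c)$ is the set of functions $u:M\to\mathbb{R}$ such that $u(\gamma(b))-u(\gamma(a))\le\int_a^bL(\gamma(s),\dot\gamma(s))\,ds+c(b-a)$ for every piecewise $C^1$ curve $\gamma:[a,b]\to M$, $a\le b$. The critical value is $c(H)=\inf\{c\in\mathbb{R}\mid\mathcal{H}(c)\ne\emptyset\}$. $\mathrm{Hom}(G,\mathbb{R})$ is the set of group homomorphisms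 $G\to\mathbb{R}$. For $g\in G$, $g^*u(x)=u(gx)$. For $\rho\in\mathrm{Hom}(G,\mathbb{R})$: $\mathcal{I}_\rho=\{u\in C^0(M,\mathbb{R})\mid \forall g\in G,\ g^*u=u+\rho(g)\}$, $\mathcal{H}_\rho(c)=\mathcal{I}_\rho\cap\mathcal{H}(c)$, $c(\rho)=\sup\{c\in\mathbb{R}\mid\mathcal{H}_\rho(c)=\emptyset\}\in\mathbb{R}\cup\{+\infty\}$, and $c_{G,min}(H)=\inf\{c(\rho)\mid\rho\in\mathrm{Hom}(G,\mathbb{R})\}$. Amenability: a discrete group $G$ is amenable if there is a left (or right) invariant mean on $l^\infty(G)$, the space of all bounded real functions on $G$. *)

(* Defs.v *)
(* Everything is stated over an arbitrary [realType] of MathComp-Analysis. *)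
From mathcomp Require Import all_boot all_order all_algebra.
From mathcomp Require Import all_classical all_reals all_analysis.
Import Order.TTheory GRing.Theory Num.Theory.
Import numFieldNormedType.Exports.

Set Implicit Arguments.
Unset Strict Implicit.
Unset Printing Implicit Defensive.

Local Open Scope classical_set_scope.
Local Open Scope ring_scope.

(* In finite dimension, [f] is C^(k+1) on the open set [U] iff it is
   differentiable there and all its directional derivatives are C^k. *)
Fixpoint Ck_on (R : realType) (V W : normedModType R) (k : nat) (U : set V)
    (f : V -> W) {struct k} : Prop :=
  match k with
  | 0 => forall x, U x -> {for x, continuous f}
  | k'.+1 => (forall x, U x -> differentiable f x) /\
             (forall v, Ck_on k' U (fun x => 'd f x v))
  end.

Definition smooth_on (R : realType) (V W : normedModType R) (U : set V)
    (f : V -> W) : Prop :=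
  forall k, Ck_on k U f.

(* [param i] is the inverse of [chart i]; both are total functions, meaningful
   only on [chart_dom i] and on its image.  [chart_at x] is a preferred chart
   around [x]: it only serves to coordinatize the tangent space at [x]. *)
Record smooth_atlas (R : realType) (n : nat) (M : topologicalType) :=
  SmoothAtlas {
  chart_index : Type;
  chart_dom : chart_index -> set M;
  chart : chart_index -> M -> 'rV[R]_n;
  param : chart_index -> 'rV[R]_n -> M;
  chart_at : M -> chart_index;
  chart_dom_open : forall i, open (chart_dom i);
  chart_img_open : forall i, open (chart i @` chart_dom i);
  chartK : forall i x, chart_dom i x -> param i (chart i x) = x;
  chart_continuous : forall i x, chart_dom i x -> {for x, continuous (chart i)};
  param_continuous : forall i y, (chart i @` chart_dom i) y ->
    {for y, continuous (param i)};
  chart_atP : forall x, chart_dom (chart_at x) x;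
  transition_smooth : forall i j,
    smooth_on (chart i @` (chart_dom i `&` chart_dom j)) (chart j \o param i)
}.

Definition chart_img (R : realType) (n : nat) (M : topologicalType)
    (A : smooth_atlas R n M) (i : chart_index A) : set 'rV[R]_n :=
  chart i @` chart_dom i.

(* T_xM is identified with R^n (row vectors) through the preferred chart at
   [x], and T*_xM with column vectors, so that the duality pairing is the
   matrix product.  Nothing below depends on the choice of [chart_at]. *)
Definition tangent (R : realType) (n : nat) (M : topologicalType)
    (A : smooth_atlas R n M) (x : M) : normedModType R := 'rV[R]_n.

Definition cotangent (R : realType) (n : nat) (M : topologicalType)
    (A : smooth_atlas R n M) (x : M) : normedModType R := 'cV[R]_n.

Definition pairing (R : realType) (n : nat) (M : topologicalType)
    (A : smooth_atlas R n M) (x : M) (p : cotangent A x) (v : tangent A x) : R :=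
  ((v : 'rV[R]_n) *m (p : 'cV[R]_n)) 0 0.

(* Jacobian at [x] of the change of coordinates from chart [i] to chart [j];
   in MathComp-Analysis, ['d f y v = v *m 'J f y]. *)
Definition chart_jac (R : realType) (n : nat) (M : topologicalType)
    (A : smooth_atlas R n M) (i j : chart_index A) (x : M) : 'M[R]_n :=
  'J (chart j \o param i) (chart i x).

(* The tangent vector at [x] whose coordinates in the chart [i] are [a]. *)
Definition tangent_of (R : realType) (n : nat) (M : topologicalType)
    (A : smooth_atlas R n M) (i : chart_index A) (x : M) (a : 'rV[R]_n) :
    tangent A x :=
  a *m chart_jac i (chart_at A x) x.

(* The covector at [x] whose coordinates in the chart [i] are [q], that is,
   whose pairing with [tangent_of i x a] is [a *m q]. *)
Definition cotangent_of (R : realType) (n : nat) (M : topologicalType)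
    (A : smooth_atlas R n M) (i : chart_index A) (x : M) (q : 'cV[R]_n) :
    cotangent A x :=
  chart_jac (chart_at A x) i x *m q.

Record riemannian_metric (R : realType) (n : nat) (M : topologicalType)
    (A : smooth_atlas R n M) := RiemannianMetric {
  metric : forall x : M, tangent A x -> tangent A x -> R;
  metric_linear : forall x (a : R) (u v w : tangent A x),
    metric (a *: u + v) w = a * metric u w + metric v w;
  metric_sym : forall x (u v : tangent A x), metric u v = metric v u;
  metric_gt0 : forall x (v : tangent A x), v != 0 -> 0 < metric v v;
  metric_smooth : forall (i : chart_index A) (a b : 'rV[R]_n),
    smooth_on (chart_img i) (fun y : 'rV[R]_n =>
      metric (tangent_of i (param i y) a) (tangent_of i (param i y) b) : R^o)
}.

Definition tnorm (R : realType) (n : nat) (M : topologicalType)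
    (A : smooth_atlas R n M) (g : riemannian_metric A) (x : M)
    (v : tangent A x) : R :=
  Num.sqrt (metric g v v).

Definition conorm (R : realType) (n : nat) (M : topologicalType)
    (A : smooth_atlas R n M) (g : riemannian_metric A) (x : M)
    (p : cotangent A x) : R :=
  sup [set pairing p v | v in [set v : tangent A x | tnorm g v <= 1]].

Definition C1_curve_on (R : realType) (n : nat) (M : topologicalType)
    (A : smooth_atlas R n M) (O : set R) (gam : R -> M) : Prop :=
  (forall t, O t -> {for t, continuous gam}) /\
  (forall i : chart_index A,
     Ck_on 1 (O `&` gam @^-1` chart_dom i) (chart i \o gam)).

(* On a closed interval, C^1 means: extends to a C^1 curve on an open
   neighbourhood of the interval. *)
Definition C1_curve_itv (R : realType) (n : nat) (M : topologicalType)
    (A : smooth_atlas R n M) (a b : R) (gam : R -> M) : Prop :=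
  exists (O : set R) (del : R -> M),
    [/\ open O, `[a, b] `<=` O, C1_curve_on A O del
      & forall t, t \in `[a, b] -> gam t = del t].

(* A curve on [a, b] is a total function of which only the restriction to
   [a, b] matters. *)
Definition piecewise_C1 (R : realType) (n : nat) (M : topologicalType)
    (A : smooth_atlas R n M) (a b : R) (gam : R -> M) : Prop :=
  exists2 s : seq R, itv_partition a b s &
    forall k, (k < size s)%N ->
      C1_curve_itv A (nth b (a :: s) k) (nth b (a :: s) k.+1) gam.

(* Meaningful wherever [gam] is differentiable, which for a piecewise C^1 curve
   fails at finitely many times at most. *)
Definition velocity (R : realType) (n : nat) (M : topologicalType)
    (A : smooth_atlas R n M) (gam : R -> M) (t : R) : tangent A (gam t) :=
  derive1 (chart (chart_at A (gam t)) \o gam) t.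

Definition riemannian_length (R : realType) (n : nat) (M : topologicalType)
    (A : smooth_atlas R n M) (g : riemannian_metric A) (a b : R)
    (gam : R -> M) : R :=
  (\int[@lebesgue_measure R]_(t in `[a, b]) tnorm g (velocity A gam t))%R.

Definition riemannian_dist (R : realType) (n : nat) (M : topologicalType)
    (A : smooth_atlas R n M) (g : riemannian_metric A) (x y : M) : R :=
  inf [set l | exists (a b : R) (gam : R -> M),
    [/\ a <= b, piecewise_C1 A a b gam, gam a = x, gam b = y
      & l = riemannian_length g a b gam]].

Definition complete_metric (R : realType) (n : nat) (M : topologicalType)
    (A : smooth_atlas R n M) (g : riemannian_metric A) : Prop :=
  forall u : nat -> M,
    (forall e : R, 0 < e -> exists N, forall k l, (N <= k)%N -> (N <= l)%N ->
       riemannian_dist g (u k) (u l) < e) ->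
    exists x : M, forall e : R, 0 < e -> exists N, forall k, (N <= k)%N ->
      riemannian_dist g (u k) x < e.

(* C^2 regularity of a function on T*M, read in the charts of T*M induced by
   the charts of M. *)
Definition C2_cotangent (R : realType) (n : nat) (M : topologicalType)
    (A : smooth_atlas R n M) (H : forall x : M, cotangent A x -> R) : Prop :=
  forall i : chart_index A,
    Ck_on 2 (chart_img i `*` [set: 'cV[R]_n])
      (fun z : 'rV[R]_n * 'cV[R]_n =>
         H (param i z.1) (cotangent_of i (param i z.1) z.2) : R^o).

Definition uniformly_superlinear (R : realType) (n : nat) (M : topologicalType)
    (A : smooth_atlas R n M) (g : riemannian_metric A)
    (H : forall x : M, cotangent A x -> R) : Prop :=
  forall K : R, 0 <= K -> exists C : R, forall (x : M) (p : cotangent A x),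
    K * conorm g p - C <= H x p.

Definition uniformly_bounded (R : realType) (n : nat) (M : topologicalType)
    (A : smooth_atlas R n M) (g : riemannian_metric A)
    (H : forall x : M, cotangent A x -> R) : Prop :=
  forall r : R, 0 <= r ->
    (ereal_sup [set h | exists (x : M) (p : cotangent A x),
                          (conorm g p <= r)%R /\ h = (H x p)%:E] < +oo)%E.

Definition fiber_hessian (R : realType) (n : nat) (M : topologicalType)
    (A : smooth_atlas R n M) (H : forall x : M, cotangent A x -> R)
    (x : M) (p q q' : cotangent A x) : R :=
  'D_q' (fun r : cotangent A x => 'D_q (H x : cotangent A x -> R^o) r) p.

Definition C2_strictly_convex (R : realType) (n : nat) (M : topologicalType)
    (A : smooth_atlas R n M) (H : forall x : M, cotangent A x -> R) : Prop :=
  forall (x : M) (p q : cotangent A x), q != 0 -> 0 < fiber_hessian H p q q.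

Definition smooth_map (R : realType) (n : nat) (M : topologicalType)
    (A : smooth_atlas R n M) (f : M -> M) : Prop :=
  continuous f /\
  forall i j : chart_index A,
    smooth_on (chart i @` (chart_dom i `&` f @^-1` chart_dom j))
      (chart j \o f \o param i).

(* The map p |-> p \o d_x f from T*_{f(x)}M to T*_xM. *)
Definition pullback (R : realType) (n : nat) (M : topologicalType)
    (A : smooth_atlas R n M) (f : M -> M) (x : M) (p : cotangent A (f x)) :
    cotangent A x :=
  'J (chart (chart_at A (f x)) \o f \o param (chart_at A x))
     (chart (chart_at A x) x) *m (p : 'cV[R]_n).

(* Each [act a] is a diffeomorphism: its inverse [act a^-1] is smooth too. *)
Record smooth_action (R : realType) (n : nat) (M : topologicalType)
    (A : smooth_atlas R n M) (G : groupType) := SmoothAction {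
  act : G -> M -> M;
  act1 : forall x, act 1%g x = x;
  actM : forall a b x, act (a * b)%g x = act a (act b x);
  act_smooth : forall a, smooth_map A (act a)
}.

Definition preserves (R : realType) (n : nat) (M : topologicalType)
    (A : smooth_atlas R n M) (G : groupType) (T : smooth_action A G)
    (H : forall x : M, cotangent A x -> R) : Prop :=
  forall (a : G) (x : M) (p : cotangent A (act T a x)),
    H (act T a x) p = H x (pullback (f := act T a) (x := x) p).

(* For the Hamiltonians considered the supremum is a maximum: p |-> H x p is
   continuous and superlinear. *)
Definition lagrangian (R : realType) (n : nat) (M : topologicalType)
    (A : smooth_atlas R n M) (H : forall x : M, cotangent A x -> R)
    (x : M) (v : tangent A x) : R :=
  sup [set pairing p v - H x p | p in [set: cotangent A x]].

Definition dominated (R : realType) (n : nat) (M : topologicalType)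
    (A : smooth_atlas R n M) (H : forall x : M, cotangent A x -> R) (c : R) :
    set (M -> R) :=
  [set u | forall (a b : R) (gam : R -> M), a <= b -> piecewise_C1 A a b gam ->
     u (gam b) - u (gam a) <=
       (\int[@lebesgue_measure R]_(t in `[a, b])
           lagrangian H (velocity A gam t))%R + c * (b - a)].

(* Critical values are extended reals, so that an infimum or a supremum over an
   empty or unbounded set has its usual value. *)
Definition critical_value (R : realType) (n : nat) (M : topologicalType)
    (A : smooth_atlas R n M) (H : forall x : M, cotangent A x -> R) : \bar R :=
  ereal_inf [set c%:E | c in [set c : R | dominated H c !=set0]].

Definition real_hom (R : realType) (G : groupType) : set (G -> R) :=
  [set rho | forall a b, rho (a * b)%g = rho a + rho b].

Definition equivariant (R : realType) (n : nat) (M : topologicalType)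
    (A : smooth_atlas R n M) (G : groupType) (T : smooth_action A G)
    (rho : G -> R) : set (M -> R) :=
  [set u | continuous (u : M -> R^o) /\
           forall a x, u (act T a x) = u x + rho a].

Definition critical_value_hom (R : realType) (n : nat) (M : topologicalType)
    (A : smooth_atlas R n M) (G : groupType) (T : smooth_action A G)
    (H : forall x : M, cotangent A x -> R) (rho : G -> R) : \bar R :=
  ereal_sup [set c%:E |
    c in [set c : R | equivariant T rho `&` dominated H c = set0]].

Definition critical_value_min (R : realType) (n : nat) (M : topologicalType)
    (A : smooth_atlas R n M) (G : groupType) (T : smooth_action A G)
    (H : forall x : M, cotangent A x -> R) : \bar R :=
  ereal_inf [set critical_value_hom T H rho | rho in @real_hom R G].

Definition linf (R : realType) (G : groupType) : set (G -> R) :=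
  [set f | exists B : R, forall a, `|f a| <= B].

(* A mean on l^oo(G); its values on unbounded functions are irrelevant. *)
Definition is_mean (R : realType) (G : groupType) (m : (G -> R) -> R) : Prop :=
  [/\ (forall (k : R) (f h : G -> R), linf f -> linf h ->
         m (fun a => k * f a + h a) = k * m f + m h),
      (forall f : G -> R, linf f -> (forall a, 0 <= f a) -> 0 <= m f)
    & m (fun=> 1) = 1].

Definition amenable (R : realType) (G : groupType) : Prop :=
  exists2 m : (G -> R) -> R, is_mean m &
    (forall (f : G -> R) (b : G), linf f -> m (fun a => f (b * a)%g) = m f) \/
    (forall (f : G -> R) (b : G), linf f -> m (fun a => f (a * b)%g) = m f).

(* Main.v *)
(* Average a dominated function u over the group: fix a base point x0 and put
   w x = m (a |-> u (a x) - u (a x0)) for a right invariant mean m.  Since the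
   Lagrangian is invariant, u o a is dominated for every a, hence so is w, and
   the functions being averaged are bounded because M is connected and dominated
   functions are locally Lipschitz, uniformly in the function.  Right invariance
   of m makes w (b x) - w x independent of x, so w is equivariant for the
   homomorphism b |-> w (b x0) - w x0. *)
Require Import Defs.
From mathcomp Require Import all_boot all_order all_algebra.
From mathcomp Require Import all_classical all_reals all_analysis.
From mathcomp Require Import measurable_realfun ring lra.
Import Order.TTheory GRing.Theory Num.Theory.
Import numFieldNormedType.Exports.

Set Implicit Arguments.
Unset Strict Implicit.
Unset Printing Implicit Defensive.

Local Open Scope classical_set_scope.
Local Open Scope ring_scope.

(** * Locally C^1 maps *)

Section LocalC1.
Variables (R : realType).

(** The first-order expansion at [x] depends only on the germ, and [diff_unique] then identifies the
    differential. *)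
Lemma near_eq_diff (V W : normedModType R) (f h : V -> W) (x : V) :
  (\forall y \near x, f y = h y) -> differentiable f x ->
  differentiable h x /\ 'd h x = 'd f x :> (V -> W).
Proof.
move=> fh df.
have fhx : f x = h x by exact: nbhs_singleton fh.
have dfc : continuous ('d f x) by exact: diff_continuous.
have E : h \o shift x = cst (h x) + 'd f x +o_ 0 id.
  apply/eqaddoP => e e0.
  have /diff_locallyP[_ /eqaddoP/(_ e e0) fE] := df.
  have fh0 : \forall y \near 0, f (y + x) = h (y + x).
    by move: fh; rewrite (near_shift 0) /= subr0.
  apply: filterS2 fE fh0 => y; rewrite !fctE /= => fE <-.
  by rewrite -fhx.
have dE := diff_unique dfc E.
by split=> //; apply/diff_locallyP; rewrite dE.
Qed.

(** Germ form of [Ck_on 1]: C^1 regularity can be composed and transported point by point, without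
    tracking open domains. *)
Definition C1_at (V W : normedModType R) (f : V -> W) (x : V) : Prop :=
  (\forall y \near x, differentiable f y) /\
  (forall v, {for x, continuous (fun y => 'd f y v)}).

Lemma C1_at_diff (V W : normedModType R) (f : V -> W) x :
  C1_at f x -> differentiable f x.
Proof. by case=> /nbhs_singleton. Qed.

Lemma C1_at_near_eq (V W : normedModType R) (f h : V -> W) (x : V) :
  (\forall y \near x, f y = h y) -> C1_at f x -> C1_at h x.
Proof.
move=> fh [df cf].
have fh2 : \forall y \near x, \forall z \near y, f z = h z by apply: near_join.
split.
  near=> y; have [] // := @near_eq_diff _ _ f h y; first by near: y.
  by near: y.
move=> v.
have dE : \forall y \near x, 'd f y v = 'd h y v.
  near=> y; have [|//|_ ->//] := @near_eq_diff _ _ f h y; first by near: y.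
  by near: y.
suff : (fun y => 'd h y v) y @[y --> x] --> 'd f x v.
  by rewrite (nbhs_singleton dE).
by apply: cvg_trans (cf v); apply: near_eq_cvg.
Unshelve. all: by end_near. Qed.

Lemma Ck_on1P (V W : normedModType R) (U : set V) (f : V -> W) :
  open U -> Ck_on 1 U f <-> (forall x, U x -> C1_at f x).
Proof.
move=> oU; split=> [[df cf] x Ux|C1]; last first.
  split=> [x /C1/C1_at_diff//|v x /C1[_]]; exact.
split; last by move=> v; exact: cf.
by apply: filterS (open_nbhs_nbhs (conj oU Ux)) => y; exact: df.
Qed.

Lemma smooth_on_C1_at n m (U : set 'rV[R]_n) (f : 'rV[R]_n -> 'rV[R]_m) x :
  open U -> smooth_on U f -> U x -> C1_at f x.
Proof. by move=> oU /(_ 1%N) /(Ck_on1P _ oU); exact. Qed.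

Lemma diff_row_sum n (W : normedModType R) (f : 'rV[R]_n -> W) y v :
  'd f y v = \sum_k v 0 k *: 'd f y (delta_mx 0 k).
Proof.
rewrite {1}(row_sum_delta v) linear_sum; apply: eq_bigr => k _.
by rewrite linearZ.
Qed.

(** [C1_at] controls the differential of [F] along fixed directions only, whereas ['d b y v] moves
    with [y]. Expanding it on the basis of the row space leaves fixed directions with continuous
    coefficients. *)
Lemma C1_at_comp (V W : normedModType R) n (b : V -> 'rV[R]_n)
    (F : 'rV[R]_n -> W) (x : V) :
  C1_at b x -> C1_at F (b x) -> C1_at (F \o b) x.
Proof.
move=> [db cb] [dF cF].
have bx : {for x, continuous b}.
  by apply: differentiable_continuous; exact: (nbhs_singleton db).
have dFb : \forall y \near x, differentiable F (b y) by exact: bx dF.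
split; first by near=> y; apply: differentiable_comp; near: y.
move=> v.
have dE : \forall y \near x,
    \sum_k ('d b y v) 0 k *: 'd F (b y) (delta_mx 0 k) = 'd (F \o b) y v.
  near=> y; rewrite [in RHS](@diff_comp _ _ _ _ b F y); [|by near: y..].
  by rewrite /= [RHS]diff_row_sum.
suff : (fun y => 'd (F \o b) y v) y @[y --> x] -->
    \sum_k ('d b x v) 0 k *: 'd F (b x) (delta_mx 0 k).
  by rewrite (nbhs_singleton dE).
apply: cvg_trans; first exact: near_eq_cvg dE.
apply: (@cvg_big _ _ +%R 0 xpredT) => [|k _]; first exact: add_continuous.
apply: cvgZ.
  exact: (continuous_comp (@cb v) (@coord_continuous _ _ _ 0 k _)).
exact: (continuous_comp bx (cF _)).
Unshelve. all: by end_near. Qed.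

End LocalC1.

(** * Integrals of possibly non-measurable functions *)

Section NonMeasurableIntegral.
Import HBNNSimple.
Context d (T : measurableType d) (R : realType) (mu : {measure set T -> \bar R}).
Local Open Scope ereal_scope.

(* The integral of a nonnegative function is the supremum of the integrals of
   the simple functions below it, so no measurability is needed: this spares us
   the measurability of the Lagrangian along a curve. *)
Lemma ge0_le_integral_negligible (D N : set T) (f h : T -> \bar R) :
  measurable N -> mu N = 0 ->
  (forall x, D x -> 0 <= f x) -> (forall x, D x -> 0 <= h x) ->
  (forall x, D x -> ~ N x -> f x <= h x) ->
  \int[mu]_(x in D) f x <= \int[mu]_(x in D) h x.
Proof.
move=> mN N0 f0 h0 fh; rewrite [leLHS]ge0_integralE // [leRHS]ge0_integralE //.
apply: ge_ereal_sup => _ [k kf <-].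
have mC : measurable (~` N) by exact: measurableC.
rewrite -integralT_nnsfun (ge0_negligible_integral mN) //.
- rewrite setTD integral_nnsfun //.
  (* [k] cut off to zero on [N] is still simple, and lies below [h] extended by 0. *)
  apply: ereal_sup_ubound; exists (proj_nnsfun k mC); last first.
    by congr sintegral; rewrite mrestrict.
  move=> x /=; have := kf x; rewrite !patchE.
  case: ifPn => [/set_mem Dx|_] kx.
    have [Nx|nNx] := pselect (N x).
      by rewrite mindicE memNset ?mulr0 ?h0//; apply.
    by rewrite mindicE mem_set // mulr1 (le_trans kx) // fh.
  by apply: le_trans kx; rewrite lee_fin ler_piMr // mindicE lern1 leq_b1.
- by apply/measurable_EFinP.
- by move=> x _; rewrite lee_fin.
Qed.

Lemma eq_integral_negligible (D N : set T) (f h : T -> \bar R) :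
  measurable N -> mu N = 0 -> (forall x, D x -> ~ N x -> f x = h x) ->
  \int[mu]_(x in D) f x = \int[mu]_(x in D) h x.
Proof.
move=> mN N0 fh; rewrite integralE [RHS]integralE; congr (_ - _);
  apply/eqP; rewrite eq_le; apply/andP; split;
  apply: (ge0_le_integral_negligible mN N0) => // x Dx Nx;
  by rewrite ?funeposE ?funenegE fh.
Qed.

End NonMeasurableIntegral.

(** Only the positive part of [f] counts for an upper bound. The integral may be -oo; its real value
    is then 0 by default, and [0 <= C] concludes. *)
Lemma Rintegral_le_cst (R : realType) (a b C : R) (f : R -> R) :
  a <= b -> 0 <= C -> (forall t, t \in `[a, b] -> f t <= C) ->
  (\int[lebesgue_measure]_(t in `[a, b]) f t)%R <= C * (b - a).
Proof.
move=> ab C0 fC.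
have Cab : (\int[lebesgue_measure]_(t in `[a, b]) C%:E = (C * (b - a))%:E)%E.
  rewrite integral_cst; last exact: measurable_itv.
  by rewrite /= lebesgue_measure_itv /= lte_fin; case: ltrgtP ab => // -> _;
    rewrite subrr mulr0 mule0.
rewrite /Rintegral.
have : (\int[lebesgue_measure]_(t in `[a, b]) (f t)%:E <= (C * (b - a))%:E)%E.
  rewrite integralE -Cab -[leRHS]sube0; apply: leeB; last exact: integral_ge0.
  apply: (@ge0_le_integral_negligible _ _ _ _ _ set0) => //.
  by move=> t /= tab _; rewrite funeposE ge_max !lee_fin fC.
case: (integral _ _ _) => [r||] /=; rewrite ?lee_fin // => _.
by rewrite mulr_ge0 // subr_ge0.
Qed.

Lemma Rintegral_eq_countable (R : realType) (D N : set R) (f h : R -> R) :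
  countable N -> (forall t, D t -> ~ N t -> f t = h t) ->
  (\int[lebesgue_measure]_(t in D) f t)%R = (\int[lebesgue_measure]_(t in D) h t)%R.
Proof.
move=> cN fh; congr fine.
apply: (@eq_integral_negligible _ _ R lebesgue_measure D N) => //.
- exact: countable_measurable.
- exact: countable_lebesgue_measure0.
- by move=> t Dt Nt; rewrite fh.
Qed.

(** * C^1 curves *)

Section Curves.
Variables (R : realType) (n : nat) (M : topologicalType) (A : smooth_atlas R n M).
Implicit Types (x : M) (i j : chart_index A) (gam : R -> M).

Lemma chart_img_chart i x : chart_dom i x -> chart_img i (chart i x).
Proof. by move=> ix; exists x. Qed.

Lemma param_dom i y : chart_img i y -> chart_dom i (param i y).
Proof. by move=> [x ix <-]; rewrite chartK. Qed.

Lemma paramK i y : chart_img i y -> chart i (param i y) = y.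
Proof. by move=> [x ix <-]; rewrite chartK. Qed.

Lemma open_chart_imgI i (U : set M) :
  open U -> open (chart i @` (chart_dom i `&` U)).
Proof.
move=> oU; rewrite openE => y [x [ix Ux] <-].
have iy : chart_img i (chart i x) by exact: chart_img_chart.
have N1 : \forall z \near chart i x, chart_img i z.
  by apply: open_nbhs_nbhs; split=> //; exact: chart_img_open.
have N2 : \forall z \near chart i x, U (param i z).
  apply: (param_continuous iy).
  by rewrite chartK //; exact: (open_nbhs_nbhs (conj oU Ux)).
apply: filterS2 N1 N2 => z iz Uz; exists (param i z); last exact: paramK.
by split=> //; exact: param_dom.
Qed.

Lemma smooth_map_C1_at (f : M -> M) i j x :
  smooth_map A f -> chart_dom i x -> chart_dom j (f x) ->
  C1_at (chart j \o f \o param i) (chart i x).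
Proof.
move=> [cf sf] ix jfx.
apply: smooth_on_C1_at (sf i j) _; last by exists x.
by apply: open_chart_imgI; move/continuousP: cf; apply; exact: chart_dom_open.
Qed.

Lemma transition_C1_at i j x : chart_dom i x -> chart_dom j x ->
  C1_at (chart j \o param i) (chart i x).
Proof.
move=> ix jx; apply: smooth_on_C1_at (transition_smooth i j) _; last by exists x.
exact: open_chart_imgI (chart_dom_open j).
Qed.

Lemma C1_curve_onP (U : set R) gam : open U ->
  C1_curve_on A U gam <->
  forall t, U t -> {for t, continuous gam} /\
    forall i, chart_dom i (gam t) -> C1_at (chart i \o gam) t.
Proof.
move=> oO; split=> [[cg C1] t Ot|C1].
  split; first exact: cg.
  move=> i it.
  suff oU : open (U `&` gam @^-1` chart_dom i).
    by have /(Ck_on1P _ oU) := C1 i; apply.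
  rewrite openE => s [Os his]; apply: filterI; first exact: open_nbhs_nbhs.
  by apply: (cg s Os); apply: open_nbhs_nbhs; split=> //; exact: chart_dom_open.
split=> [t /C1[]//|i].
apply/Ck_on1P; last by move=> t [Ot it]; have [_] := C1 t Ot; exact.
rewrite openE => s [Os his]; apply: filterI; first exact: open_nbhs_nbhs.
have [cg _] := C1 s Os.
by apply: cg; apply: open_nbhs_nbhs; split=> //; exact: chart_dom_open.
Qed.

Lemma C1_curve_on_chart (U : set R) (b : R -> 'rV[R]_n) i : open U ->
  (forall t, U t -> C1_at b t /\ chart_img i (b t)) ->
  C1_curve_on A U (param i \o b).
Proof.
move=> oO C1; apply/C1_curve_onP => // t /C1 [C1b ib]; split.
  apply: continuous_comp; last exact: param_continuous.
  exact: differentiable_continuous (C1_at_diff C1b).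
move=> j jt; apply: (@C1_at_comp _ _ _ _ b (chart j \o param i)) => //.
by rewrite -(paramK ib); apply: transition_C1_at => //; exact: param_dom.
Qed.

Lemma C1_curve_on_comp (U : set R) gam (f : M -> M) :
  open U -> smooth_map A f -> C1_curve_on A U gam -> C1_curve_on A U (f \o gam).
Proof.
move=> oO sf /(C1_curve_onP _ oO) C1; apply/C1_curve_onP => // t /C1 [cg C1g].
have [cf _] := sf.
split; first by apply: continuous_comp => //; exact: cf.
move=> j jt; pose i := chart_at A (gam t); have it := chart_atP A (gam t).
(* Near [t] the curve stays in the chart [i], so [f \o gam] factors through it. *)
apply: (@C1_at_near_eq _ _ _ ((chart j \o f \o param i) \o (chart i \o gam))).
  have : \forall s \near t, chart_dom i (gam s).
    by apply: cg; apply: open_nbhs_nbhs; split=> //; exact: chart_dom_open.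
  by apply: filterS => s his /=; rewrite chartK.
apply: C1_at_comp; first exact: C1g.
exact: smooth_map_C1_at.
Qed.

Lemma piecewise_C1_comp (a b : R) gam (f : M -> M) :
  smooth_map A f -> piecewise_C1 A a b gam -> piecewise_C1 A a b (f \o gam).
Proof.
move=> sf [s ps C1]; exists s => // k ks; have [U [del [oO abO C1d gd]]] := C1 k ks.
exists U, (f \o del); split=> //; first exact: C1_curve_on_comp.
by move=> t /gd /= ->.
Qed.

Lemma between_consecutive (d t a : R) (s : seq R) :
  a < t -> t <= last a s -> t \notin s ->
  exists2 k, (k < size s)%N & nth d (a :: s) k < t < nth d (a :: s) k.+1.
Proof.
elim: s a => [|x s IHs] a at_ /=; first by rewrite leNgt at_.
rewrite inE negb_or => ts /andP[tx tns].
have [xt|tx'] := ltP x t; last by exists 0%N => //=; rewrite at_ lt_neqAle tx.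
by have [k ks] := IHs x xt ts tns; exists k.+1.
Qed.

(** The exceptional set consists of the breakpoints: near any other time the curve agrees with the
    C^1 extension of one piece. *)
Lemma piecewise_C1_differentiable (a b : R) gam : piecewise_C1 A a b gam ->
  exists2 N : set R, countable N & forall t, t \in `[a, b] -> ~ N t ->
    {for t, continuous gam} /\
    forall i, chart_dom i (gam t) -> differentiable (chart i \o gam) t.
Proof.
move=> [s ps C1]; exists [set t | t \in a :: s].
  exact: finite_set_countable (finite_seq _).
move=> t tab tN.
have /andP[at_ tb] : a < t <= b.
  move: tab tN; rewrite in_itv /= inE => /andP[at_ ->] /negP.
  by rewrite negb_or andbT lt_neqAle eq_sym at_ andbT => /andP[].
have [k ks /andP[tk1 tk2]] : exists2 k, (k < size s)%N &
    nth b (a :: s) k < t < nth b (a :: s) k.+1.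
  apply: between_consecutive => //; last by move/negP: tN; rewrite inE => /norP[].
  by case: ps => _ /eqP ->.
have [U [del [oO abO C1d gd]]] := C1 k ks.
have ngd : \forall u \near t, gam u = del u.
  have : t \in `](nth b (a :: s) k), (nth b (a :: s) k.+1)[.
    by rewrite in_itv /= tk1.
  move/near_in_itvoo; apply: filterS => u uk; apply: gd.
  by apply: subset_itv_oo_cc uk.
have gt := nbhs_singleton ngd.
have Ot : U t by apply: abO; rewrite /= in_itv /= !ltW.
have /(C1_curve_onP _ oO)/(_ t Ot)[cd C1dt] := C1d.
have ngd' : \forall u \near t, del u = gam u by apply: filterS ngd.
split.
  suff : gam u @[u --> t] --> del t by rewrite -gt.
  apply: cvg_trans cd; exact: near_eq_cvg.
move=> i; rewrite gt => /C1dt /C1_at_diff dd.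
by have [] := near_eq_diff (filterS (fun u e => congr1 (chart i) e) ngd') dd.
Qed.

End Curves.

(** * Invariance under the action *)

Section Invariance.
Variables (R : realType) (n : nat) (M : topologicalType) (A : smooth_atlas R n M).
Implicit Types (x : M) (i j : chart_index A) (gam : R -> M).

Lemma derive1_comp_jacobian (b : R -> 'rV[R]_n) (F : 'rV[R]_n -> 'rV[R]_n) t :
  differentiable b t -> differentiable F (b t) ->
  derive1 (F \o b) t = derive1 b t *m 'J F (b t).
Proof.
move=> db dF; have dFb : differentiable (F \o b) t by exact: differentiable_comp.
rewrite (derive1E' dFb) (derive1E' db).
apply: etrans (congr1 (fun h => h 1) (diff_comp db dF)) _.
exact: (esym (mul_rV_lin1 ('d F (b t)) ('d b t 1))).
Qed.

Lemma jacobian_comp_id (F F' : 'rV[R]_n -> 'rV[R]_n) y :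
  differentiable F y -> differentiable F' (F y) ->
  (\forall z \near y, F' (F z) = z) -> 'J F y *m 'J F' (F y) = 1%:M.
Proof.
move=> dF dF' FF; apply/row_matrixP => k; rewrite !rowE mulmxA mulmx1 !mul_rV_lin1.
have [] := @near_eq_diff _ _ _ id (F' \o F) y.
- by apply: filterS FF => z /= ->.
- exact: ex_diff.
move=> _ E.
apply: etrans (esym (congr1 (fun h => h (delta_mx 0 k)) (diff_comp dF dF'))) _.
by rewrite E diff_val.
Qed.

(** Matrix of the differential of [f] in the preferred charts, the one by which [pullback]
    multiplies covectors; tangent row vectors multiply it from the left. *)
Definition map_jacobian (f : M -> M) x : 'M[R]_n :=
  'J (chart (chart_at A (f x)) \o f \o param (chart_at A x))
     (chart (chart_at A x) x).

Lemma velocity_comp gam (f : M -> M) t :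
  smooth_map A f -> {for t, continuous gam} ->
  differentiable (chart (chart_at A (gam t)) \o gam) t ->
  velocity A (f \o gam) t = (velocity A gam t : 'rV_n) *m map_jacobian f (gam t).
Proof.
move=> sf cg dg; rewrite /velocity /map_jacobian.
set i := chart_at A (gam t); set j := chart_at A _.
have it : chart_dom i (gam t) by exact: chart_atP.
have jt : chart_dom j (f (gam t)) by exact: chart_atP.
rewrite -[chart i (gam t)]/((chart i \o gam) t) -derive1_comp_jacobian //; last first.
  exact/C1_at_diff/smooth_map_C1_at.
rewrite !derive1E; apply: near_eq_derive.
have : \forall s \near t, chart_dom i (gam s).
  by apply: cg; apply: open_nbhs_nbhs; split=> //; exact: chart_dom_open.
by apply: filterS => s his /=; rewrite chartK.
Qed.

Lemma velocity_chart i (b : R -> 'rV[R]_n) t :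
  chart_img i (b t) -> differentiable b t ->
  velocity A (param i \o b) t = tangent_of i (param i (b t)) (derive1 b t).
Proof.
move=> ib db; rewrite /velocity /tangent_of /chart_jac paramK //.
set j := chart_at A _.
rewrite -derive1_comp_jacobian //.
rewrite -[b t](paramK ib); apply/C1_at_diff/transition_C1_at.
  exact: param_dom.
exact: chart_atP.
Qed.

Variables (G : groupType) (T : smooth_action A G).

Lemma actK (a : G) x : act T a^-1%g (act T a x) = x.
Proof. by rewrite -actM mulVg act1. Qed.

Lemma map_jacobian_actV (a : G) x :
  map_jacobian (act T a) x *m map_jacobian (act T a^-1%g) (act T a x) = 1%:M.
Proof.
(* [actK] makes the target chart of the second factor the preferred chart at [x], so the two
   matrices belong to locally inverse coordinate maps. *)
rewrite /map_jacobian actK.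
set i := chart_at A x; set j := chart_at A _.
have ix : chart_dom i x by exact: chart_atP.
have jx : chart_dom j (act T a x) by exact: chart_atP.
have E : (chart j \o act T a \o param i) (chart i x) = chart j (act T a x).
  by rewrite /= chartK.
rewrite -E; apply: jacobian_comp_id.
- exact/C1_at_diff/(smooth_map_C1_at (act_smooth T a)).
- rewrite E; apply/C1_at_diff/(smooth_map_C1_at (act_smooth T _)) => //.
  by rewrite actK.
have ci : chart_img i (chart i x) by exact: chart_img_chart.
have N1 : \forall z \near chart i x, chart_img i z.
  by apply: open_nbhs_nbhs; split=> //; exact: chart_img_open.
have N2 : \forall z \near chart i x, chart_dom j (act T a (param i z)).
  have : {for chart i x, continuous (act T a \o param i)}.
    apply: continuous_comp; first exact: param_continuous.
    by have [ca _] := act_smooth T a; exact: ca.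
  apply; apply: open_nbhs_nbhs; split; first exact: chart_dom_open.
  by rewrite /= chartK.
by apply: filterS2 N1 N2 => z iz jz /=; rewrite chartK // actK paramK.
Qed.

Variable (H : forall x : M, cotangent A x -> R).
Hypothesis HG : preserves T H.

(** Invariance of [H] turns the supremum over covectors at [act T a x] into one over their
    pullbacks; these exhaust the cotangent space at [x] because the Jacobian is invertible. *)
Lemma lagrangian_act (a : G) x (v : 'rV[R]_n) :
  lagrangian H (x := act T a x) (v *m map_jacobian (act T a) x)
  = lagrangian H (x := x) v.
Proof.
congr sup; apply/seteqP; split=> _ [p _ <-].
  exists (map_jacobian (act T a) x *m p) => //.
  by rewrite HG /pairing -!mulmxA.
exists (map_jacobian (act T a^-1%g) (act T a x) *m p) => //.
rewrite HG /pairing /pullback -/(map_jacobian (act T a) x).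
by rewrite -mulmxA !(mulmxA (map_jacobian _ _)) map_jacobian_actV mul1mx.
Qed.

(** The action carries piecewise C^1 curves to such curves with, outside countably many times, the
    same Lagrangian integrand. *)
Lemma dominated_act c u (a : G) :
  dominated H c u -> dominated H c (u \o act T a).
Proof.
move=> du s t gam st pg.
have := du s t (act T a \o gam) st (piecewise_C1_comp (act_smooth T a) pg).
have [N cN gN] := piecewise_C1_differentiable pg.
rewrite (@Rintegral_eq_countable _ _ N _
  (fun r => lagrangian H (velocity A gam r))) // => r rst Nr.
have [cg dg] := gN r rst Nr.
rewrite velocity_comp //; first exact: lagrangian_act.
  exact: act_smooth.
exact/dg/chart_atP.
Qed.

End Invariance.

(** * Bounds on the Lagrangian *)

Section Metric.
Variables (R : realType) (n : nat) (M : topologicalType) (A : smooth_atlas R n M).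
Variable g : riemannian_metric A.
Implicit Types (x : M) (i j : chart_index A).

Lemma metric0l x (w : tangent A x) : metric g (0 : tangent A x) w = 0.
Proof.
have := metric_linear g 1 (0 : tangent A x) 0 w.
rewrite scaler0 addr0; lra.
Qed.

Lemma metricZl x (a : R) (v w : tangent A x) :
  metric g (a *: v) w = a * metric g v w.
Proof. by rewrite -[a *: v]addr0 metric_linear metric0l addr0. Qed.

Lemma metricDl x (u v w : tangent A x) :
  metric g (u + v) w = metric g u w + metric g v w.
Proof. by rewrite -[u in LHS]scale1r metric_linear mul1r. Qed.

Lemma metric_suml x (c : 'I_n -> R) (e : 'I_n -> 'rV[R]_n) (w : tangent A x) :
  metric g (\sum_k c k *: e k : tangent A x) w =
  \sum_k c k * metric g (e k : tangent A x) w.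
Proof.
apply: (big_rec2 (fun v r => metric g (v : tangent A x) w = r)).
  exact: metric0l.
by move=> k v r _ <-; rewrite (@metricDl x) (@metricZl x).
Qed.

Lemma metric_sumr x (c : 'I_n -> R) (e : 'I_n -> 'rV[R]_n) (w : tangent A x) :
  metric g w (\sum_k c k *: e k : tangent A x) =
  \sum_k c k * metric g w (e k : tangent A x).
Proof.
rewrite Defs.metric_sym metric_suml; apply: eq_bigr => k _.
by rewrite Defs.metric_sym.
Qed.

Definition gram x : 'M[R]_n :=
  \matrix_(k, l) metric g (delta_mx 0 k : tangent A x) (delta_mx 0 l : tangent A x).

Lemma metric_gram x (v w : 'rV[R]_n) :
  metric g (v : tangent A x) (w : tangent A x) = (v *m gram x *m w^T) 0 0.
Proof.
rewrite {1}(row_sum_delta w) metric_sumr mxE; apply: eq_bigr => l _.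
rewrite {1}(row_sum_delta v) metric_suml mulrC !mxE; congr (_ * _).
by apply: eq_bigr => k _; rewrite !mxE.
Qed.

Lemma metric_ge0 x (v : tangent A x) : 0 <= metric g v v.
Proof.
have [->|/(metric_gt0 g)/ltW//] := eqVneq v 0.
by rewrite metric0l.
Qed.

Lemma gram_unit x : gram x \in unitmx.
Proof.
rewrite -row_free_unit; apply: inj_row_free => v v0.
apply/eqP/negPn/negP => /(metric_gt0 (x := x) g).
by rewrite metric_gram v0 mul0mx mxE ltxx.
Qed.

(** Riesz representation, obtained by inverting the Gram matrix. *)
Lemma pairing_metric x (p : cotangent A x) :
  exists w : tangent A x, forall v, pairing p v = metric g v w.
Proof.
exists (invmx (gram x) *m (p : 'cV[R]_n))^T => v.
by rewrite metric_gram trmxK -mulmxA mulKVmx // gram_unit.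
Qed.

Lemma tnorm_sqr x (v : tangent A x) : tnorm g v ^+ 2 = metric g v v.
Proof. exact/sqr_sqrtr/metric_ge0. Qed.

(** This makes the [sup] in [conorm] a genuine supremum. With [w] representing [p], positivity of
    the metric at [v - w] bounds twice the pairing by [metric g v v + metric g w w]. *)
Lemma pairing_has_ubound x (p : cotangent A x) :
  has_ubound [set pairing p v | v in [set v : tangent A x | tnorm g v <= 1]].
Proof.
have [w pw] := pairing_metric p.
exists (1 + metric g w w) => _ [v /= v1 <-]; rewrite pw.
have vv1 : metric g v v <= 1.
  by rewrite -tnorm_sqr expr_le1 //; exact: sqrtr_ge0.
have : 0 <= metric g (v - w) (v - w) by exact: metric_ge0.
have := metric_ge0 w.
have -> : v - w = (-1) *: w + v by rewrite scaleN1r addrC.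
rewrite metric_linear !(Defs.metric_sym g _ ((-1) *: w + v)) !metric_linear.
rewrite (Defs.metric_sym g v w); lra.
Qed.

Lemma pairing_le x (p : cotangent A x) (v : tangent A x) :
  pairing p v <= conorm g p * tnorm g v.
Proof.
have [->|v0] := eqVneq v 0.
  rewrite /pairing mul0mx mxE mulr_ge0 ?sqrtr_ge0 //.
  apply: ub_le_sup; first exact: pairing_has_ubound.
  exists 0; last by rewrite /pairing mul0mx mxE.
  by rewrite /= /tnorm metric0l sqrtr0.
have s0 : 0 < tnorm g v by rewrite sqrtr_gt0 metric_gt0.
rewrite -ler_pdivrMr //; apply: ub_le_sup; first exact: pairing_has_ubound.
exists ((tnorm g v)^-1 *: v); last by rewrite /pairing -scalemxAl mxE mulrC.
rewrite /= [leLHS]/tnorm metricZl Defs.metric_sym metricZl -tnorm_sqr mulrA.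
by rewrite -expr2 -exprMn mulVf ?expr1n ?sqrtr1 // gt_eqF.
Qed.

(** Where the speed is at most [K], the term [K * conorm g p] absorbs the pairing, so [C] bounds the
    Lagrangian whatever the base point. *)
Lemma lagrangian_le (H : forall x, cotangent A x -> R) (K C : R) :
  (forall x (p : cotangent A x), K * conorm g p - C <= H x p) ->
  forall x (v : tangent A x), tnorm g v <= K -> lagrangian H v <= C.
Proof.
move=> HK x v vK; apply: ge_sup.
  by exists (pairing (0 : cotangent A x) v - H x 0), 0.
move=> _ [p _ <-]; have := HK x p; have := pairing_le p v.
have c0 : 0 <= conorm g p.
  apply: ub_le_sup; first exact: pairing_has_ubound.
  exists 0; last by rewrite /pairing mul0mx mxE.
  by rewrite /= /tnorm metric0l sqrtr0.
have := ler_wpM2l c0 vK; lra.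
Qed.

(** By continuity each of the finitely many metric coefficients grows by at most 1 in absolute value
    near [chart i x]. The norm on row vectors is the largest coordinate, so the squared Riemannian
    norm is at most the sum of these bounds. *)
Lemma tnorm_locally_bounded i x : chart_dom i x ->
  exists2 K : R, 0 <= K & \forall y \near chart i x, forall a : 'rV[R]_n,
    `|a| <= 1 -> tnorm g (tangent_of i (param i y) a) <= K.
Proof.
move=> ix.
pose m y k l := metric g (tangent_of i (param i y) (delta_mx 0 k))
                         (tangent_of i (param i y) (delta_mx 0 l)).
pose K := \sum_k \sum_l (`|m (chart i x) k l| + 1).
exists (Num.sqrt K); first exact: sqrtr_ge0.
have mkl k l : \forall y \near chart i x, `|m y k l| <= `|m (chart i x) k l| + 1.
  have cm : {for chart i x, continuous (fun y => m y k l)}.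
    (* Smoothness at order 0 is continuity. *)
    refine (@metric_smooth _ _ _ _ g i (delta_mx 0 k) (delta_mx 0 l)
              0%N _ (chart_img_chart ix)).
  by apply: (@cvgr_norm_le _ _ _ _ _ _ _ cm); rewrite ltrDl.
have mK := filter_forall _ (fun k => filter_forall _ (mkl k)).
near=> y => a a1; have mKy k l : `|m y k l| <= `|m (chart i x) k l| + 1.
  by move: k l; near: y; exact: mK.
apply: ler_wsqrtr.
have -> : tangent_of i (param i y) a =
    \sum_k a 0 k *: (tangent_of i (param i y) (delta_mx 0 k) : 'rV_n).
  rewrite /tangent_of {1}(row_sum_delta a) mulmx_suml; apply: eq_bigr => k _.
  by rewrite -scalemxAl.
have a1k k : `|a 0 k| <= 1.
  apply: le_trans a1; rewrite /Num.norm /= mx_normrE.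
  exact: (le_bigmax _ (fun ij => `|a ij.1 ij.2|) (0, k)).
rewrite metric_suml; apply: ler_sum => k _.
rewrite metric_sumr mulr_sumr; apply: ler_sum => l _.
apply: le_trans (ler_norm _) _; rewrite !normrM.
apply: le_trans (mKy k l); rewrite mulrA ler_piMl // mulr_ile1.
Unshelve. all: by end_near. Qed.

End Metric.

(** * Dominated functions are locally Lipschitz *)

Section Lipschitz.
Variables (R : realType) (n : nat) (M : topologicalType) (A : smooth_atlas R n M).
Implicit Types (x : M) (i : chart_index A).

Lemma C1_at_affine (y a : 'rV[R]_n) t :
  C1_at (fun s : R => y + s *: a) t /\ derive1 (fun s : R => y + s *: a) t = a.
Proof.
have D (s : R) : is_diff s (fun s : R => y + s *: a) ( *:%R^~ a).
  have : is_diff s (cst y + ( *:%R^~ a)) (0 + ( *:%R^~ a)) by exact: is_diffD.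
  by rewrite add0r.
have dE s v : 'd (fun s : R => y + s *: a) s v = v *: a.
  by rewrite (@diff_val _ _ _ _ _ _ _ (D s)).
split; last first.
  by rewrite derive1E' ?dE ?scale1r //; exact: (@ex_diff _ _ _ _ _ _ _ (D t)).
split; first by near=> s; exact: (@ex_diff _ _ _ _ _ _ _ (D s)).
move=> v.
have -> : (fun s => 'd (fun s : R => y + s *: a) s v) = cst (v *: a).
  by apply/funext => s; exact: dE.
exact: cst_continuous.
Unshelve. all: by end_near. Qed.

(** [C] and [N] are fixed before [u]: this uniformity lets one estimate serve all translates of a
    dominated function. Two points of a chart ball are joined by a segment along which the
    Riemannian speed, hence the Lagrangian, is bounded. *)
Lemma dominated_lipschitz (g : riemannian_metric A)
    (H : forall x : M, cotangent A x -> R) (c : R) x :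
  uniformly_superlinear g H ->
  exists (C : R) (N : set M), [/\ 0 <= C, nbhs x N &
    forall y z u, N y -> N z -> dominated H c u ->
      `|u z - u y| <= C * `|chart (chart_at A x) z - chart (chart_at A x) y|].
Proof.
move=> sH; set i := chart_at A x; have ix : chart_dom i x by exact: chart_atP.
(* [K] bounds the Riemannian norm of coordinate vectors of norm at most 1; [CK] then bounds the
   Lagrangian on them. *)
have [K K0 gK] := tnorm_locally_bounded g ix.
have [CK HK] := sH K K0.
have N1 : \forall y \near chart i x, chart_img i y.
  apply: open_nbhs_nbhs; split; first exact: chart_img_open.
  exact: chart_img_chart.
have [r /= r0 br] := iffLR (@nbhs_ballP R 'rV[R]_n (chart i x) _) (filterI N1 gK).
rewrite -ball_normE /= in br.
pose N y := chart_dom i y /\ `|chart i x - chart i y| < r.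
exists (`|CK| + `|c|), N; split; first by rewrite addr_ge0.
  apply: filterI.
    by apply: open_nbhs_nbhs; split=> //; exact: chart_dom_open.
  by apply: (cvgr_dist_lt (chart i)) => //; exact: chart_continuous.
(* Exchanging [y] and [z] gives the absolute value. *)
suff key y z u : N y -> N z -> dominated H c u ->
    u z - u y <= (`|CK| + `|c|) * `|chart i z - chart i y|.
  move=> y z u Ny Nz du; rewrite ler_norml key // andbT lerNl opprB distrC.
  exact: key.
move=> [iy yr] [iz zr] du.
set y' := chart i y in yr *; set z' := chart i z in zr *.
(* Join y to z by the segment travelled at unit speed in the chart. *)
have [yz|yz] := eqVneq z' y'.
  by rewrite -(chartK iy) -(chartK iz) -/z' yz !subrr normr0 mulr0.
set t := `|z' - y'|.
have t0 : 0 < t by rewrite normr_gt0 subr_eq0.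
pose a := t^-1 *: (z' - y').
pose b (s : R) := y' + s *: a.
have [C1b db] : (forall s, C1_at b s) /\ (forall s, derive1 b s = a).
  by split=> s; have [] := C1_at_affine y' a s.
have a1 : `|a| <= 1.
  by rewrite normrZ ger0_norm ?invr_ge0 ?(ltW t0) // mulVf // gt_eqF.
have bt : b t = z' by rewrite /b /a scalerA divff ?gt_eqF // scale1r addrC subrK.
have b0 : b 0 = y' by rewrite /b scale0r addr0.
(* Convexity of the ball: [b s] is a convex combination of [y'] and [z']. *)
have bU s : s \in `[0, t] -> `|chart i x - b s| < r.
  rewrite in_itv /= => /andP[s0 st].
  have -> : chart i x - b s =
      (1 - s / t) *: (chart i x - y') + (s / t) *: (chart i x - z').
    by apply/rowP => k; rewrite !mxE mulrA; ring.
  have q0 : 0 <= s / t by rewrite divr_ge0 // ltW.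
  have q1 : s / t <= 1 by rewrite ler_pdivrMr // mul1r.
  move: (s / t) q0 q1 => q q0 q1.
  apply: le_lt_trans (ler_normD _ _) _; rewrite !normrZ.
  rewrite (ger0_norm q0) (@ger0_norm _ (1 - q)) ?subr_ge0 //.
  move: `|_ - y'| `|_ - z'| yr zr => m1 m2 m1r m2r.
  by have [m12|/ltW m21] := lerP m1 m2; nra.
(* C^1 on a closed interval asks for an extension to an open set; [b] is affine on the whole line,
   and [U] keeps it inside the chart. *)
pose U := [set s | `|chart i x - b s| < r].
have oU : open U.
  have -> : U = b @^-1` ball (chart i x) r by rewrite -ball_normE.
  apply: open_comp; last exact: ball_open.
  by move=> s _; exact/differentiable_continuous/C1_at_diff.
have C1U : C1_curve_on A U (param i \o b).
  by apply: C1_curve_on_chart => // s /br [].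
have pC1 : piecewise_C1 A 0 t (param i \o b).
  exists [:: t]; first exact: itv_partition1.
  by move=> [|//] _; exists U, (param i \o b).
have := du 0 t _ (ltW t0) pC1.
rewrite /= bt b0 !chartK // subr0.
have : (\int[lebesgue_measure]_(s in `[0%R, t])
    lagrangian H (velocity A (param i \o b) s))%R <= `|CK| * (t - 0).
  apply: Rintegral_le_cst => // [|s /bU /br [ib gb]]; first exact: ltW.
  apply: le_trans (ler_norm _); apply: (lagrangian_le HK).
  have dbs : differentiable b s by exact: C1_at_diff.
  by rewrite (velocity_chart ib dbs) db; exact: gb.
have := ler_norm c; nra.
Qed.

End Lipschitz.

(** * Averaging *)

Section Mean.
Variables (R : realType) (G : groupType).
Implicit Types (f h : G -> R).

Lemma linfD (k : R) f h : linf f -> linf h -> linf (fun a => k * f a + h a).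
Proof.
move=> [B fB] [C hC]; exists (`|k| * B + C) => a.
by rewrite (le_trans (ler_normD _ _)) // lerD // normrM ler_wpM2l.
Qed.

Lemma linf_cst (k : R) : linf (fun _ : G => k).
Proof. by exists `|k|. Qed.

Lemma linfB f h : linf f -> linf h -> linf (fun a => f a - h a).
Proof.
move=> lf lh; have := linfD (-1) lh lf.
by congr linf; apply/funext => a; lra.
Qed.

(** Precomposing with inversion turns left translations into right ones. *)
Lemma amenable_right : amenable R G -> exists2 m : (G -> R) -> R, is_mean m &
  forall f b, linf f -> m (fun a => f (a * b)%g) = m f.
Proof.
move=> [m [mlin mpos m1] [linv|rinv]]; last by exists m.
have linfV f : linf f -> linf (fun a => f a^-1%g) by move=> [B fB]; exists B.
exists (fun f => m (fun a => f a^-1%g)).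
  split=> [k f h lf lh|f lf f0|//]; first by rewrite mlin //; exact: linfV.
  by apply: mpos; [exact: linfV|].
move=> f b lf; rewrite -(linv _ b^-1%g (linfV _ lf)); congr m.
by apply/funext => a; rewrite invgM invgK.
Qed.

Variable m : (G -> R) -> R.
Hypothesis mm : is_mean m.

Lemma mean_cst k : m (fun=> k) = k.
Proof.
have [mlin _ m1] := mm.
(* The instance [1 * 0 + 0] of linearity forces the mean of zero to vanish. *)
have := mlin 1 _ _ (linf_cst 0) (linf_cst 0).
under [X in m X]eq_fun do rewrite mulr0 addr0.
move=> m0; have := mlin k _ _ (linf_cst 1) (linf_cst 0).
under [X in m X]eq_fun do rewrite mulr1 addr0.
rewrite m1; lra.
Qed.

Lemma meanB f h : linf f -> linf h -> m (fun a => f a - h a) = m f - m h.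
Proof.
have [mlin _ m1] := mm; move=> lf lh; have := mlin (-1) _ _ lh lf.
rewrite mulN1r addrC => <-; congr m; apply/funext => a; lra.
Qed.

Lemma mean_le f k : linf f -> (forall a, f a <= k) -> m f <= k.
Proof.
have [_ mpos _] := mm; move=> lf fk.
rewrite -subr_ge0 -{1}[k]mean_cst -meanB //; last exact: linf_cst.
apply: mpos => [|a]; last by rewrite subr_ge0.
by apply: linfB => //; exact: linf_cst.
Qed.

End Mean.

(** * Equivariant dominated functions *)

Section CriticalValue.
Variables (R : realType) (n : nat) (M : topologicalType) (A : smooth_atlas R n M).
Variables (g : riemannian_metric A) (H : forall x : M, cotangent A x -> R).
Hypothesis sH : uniformly_superlinear g H.

Lemma dominated_continuous c u : dominated H c u -> continuous (u : M -> R^o).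
Proof.
move=> du x; have [C [N [C0 Nx uC]]] := dominated_lipschitz c x sH.
set i := chart_at A x in uC.
have cx : {for x, continuous (chart i)} by apply/chart_continuous/chart_atP.
apply/cvgrPdist_lt => e e0.
(* [C] may be 0, so the division is by [C + 1]. *)
have zx : \forall z \near x, `|chart i x - chart i z| < e / (C + 1).
  by apply: (cvgr_dist_lt (chart i)) => //; rewrite divr_gt0 // ltr_wpDl.
have Nxx := nbhs_singleton Nx.
apply: filterS2 zx Nx => z zx Nz.
apply: le_lt_trans (uC z x u Nz Nxx du) _.
apply: (@le_lt_trans _ _ ((C + 1) * `|chart i x - chart i z|)).
  by rewrite ler_wpM2r // lerDl.
by rewrite mulrC -ltr_pdivlMr ?ltr_wpDl.
Qed.

Variables (G : groupType) (T : smooth_action A G).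
Hypothesis HG : preserves T H.

(** All translates [u \o act T a] are dominated, so near any point their increments obey a Lipschitz
    bound free of [a]. Boundedness thus spreads between any two points of a neighbourhood, and the
    set of good [y] is open and closed. *)
Lemma orbit_bounded c u : connected [set: M] -> dominated H c u ->
  forall x y, linf (fun a => u (act T a y) - u (act T a x)).
Proof.
move=> cM du x y.
pose B := [set y | linf (fun a => u (act T a y) - u (act T a x))].
have loc (z : M) : exists2 N : set M, nbhs z N & forall v w, N v -> N w -> B v -> B w.
  have [C [N [C0 Nz uC]]] := dominated_lipschitz c z sH.
  exists N => // v w Nv Nw [K vK].
  exists (C * `|chart (chart_at A z) w - chart (chart_at A z) v| + K) => a.
  rewrite -[X in `|X|](@subrKA _ (u (act T a v))).
  apply: le_trans (ler_normD _ _) _; apply: lerD => //.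
  exact: (uC v w (u \o act T a)) (dominated_act HG a du).
suff BT : B = setT by rewrite -[linf _]/(B y) BT.
apply: cM.
- by exists x; exists 0 => a; rewrite subrr normr0.
- exists B; last by rewrite setTI.
  rewrite openE => z Bz; have [N Nz NB] := loc z.
  have Nzz := nbhs_singleton Nz.
  by apply: filterS Nz => w Nw; exact: NB Bz.
- exists B; last by rewrite setTI.
  move=> z clz; have [N Nz NB] := loc z.
  have [w [Bw Nw]] := clz _ Nz.
  by apply: (NB w) => //; exact: nbhs_singleton.
Qed.

Lemma equivariant_dominated c u : connected [set: M] -> amenable R G ->
  dominated H c u ->
  exists2 rho, @real_hom R G rho & equivariant T rho `&` dominated H c !=set0.
Proof.
move=> cM /amenable_right[m mm minv] du.
(* If [M] is empty there is no base point, but equivariance is vacuous. *)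
have [[x0 _]|M0] := pselect (exists x : M, True); last first.
  exists (fun=> 0) => [a b|]; first by rewrite addr0.
  exists u; split=> //; split; first exact: dominated_continuous du.
  by move=> a x; case: M0; exists x.
have bd := orbit_bounded cM du.
(* The functions [a |-> u (act T a x)] may be unbounded; subtracting the value at [x0] gives the
   mean a bounded argument, and [wB] shows that [x0] cancels in differences. *)
pose w x := m (fun a => u (act T a x) - u (act T a x0)).
have wB x y : w y - w x = m (fun a => u (act T a y) - u (act T a x)).
  rewrite -meanB //; congr m; apply/funext => a; lra.
have dw : dominated H c w.
  move=> s t gam st pg; rewrite wB; apply: mean_le => // a.
  exact: (dominated_act HG a du).
pose rho b := w (act T b x0) - w x0.
have wrho b x : w (act T b x) = w x + rho b.
  apply/eqP; rewrite addrC -subr_eq /rho !wB -subr_eq0 -meanB //.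
  (* The defect of equivariance is the mean of [f (a * b) - f a], zero by right invariance. *)
  pose f a := u (act T a x) - u (act T a x0).
  have lf : linf f by exact: bd.
  have <- : m (fun a => f (a * b)%g - f a) = 0.
    rewrite meanB ?minv ?subrr //.
    by have [K fK] := lf; exists K.
  apply/eqP; congr m; apply/funext => a; rewrite /f !actM; lra.
exists rho => [a b|]; first by rewrite /rho actM !wrho; lra.
exists w; split=> //; split=> //; exact: dominated_continuous dw.
Qed.

Lemma dominated_le c c' u : c <= c' -> dominated H c u -> dominated H c' u.
Proof.
move=> cc du s t gam st pg; apply: le_trans (du _ _ _ st pg) _.
by rewrite lerD2l ler_wpM2r // subr_ge0.
Qed.

End CriticalValue.

(** * Comparison of the two critical values *)

Theorem theorem7p4 (R : realType) (n : nat) (M : topologicalType)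
    (A : smooth_atlas R n M) (g : riemannian_metric A)
    (H : forall x : M, cotangent A x -> R)
    (G : groupType) (T : smooth_action A G) :
  hausdorff_space M -> @second_countable M -> connected [set: M] ->
  complete_metric g ->
  C2_cotangent H -> uniformly_superlinear g H -> uniformly_bounded g H ->
  C2_strictly_convex H ->
  preserves T H ->
  amenable R G ->
  critical_value_min T H = critical_value H.
Proof.
move=> _ _ cM _ _ sH _ _ HG aG; apply/eqP; rewrite eq_le; apply/andP; split.
  apply: le_ereal_inf_tmp => _ [c [u du] <-].
  have [rho hrho [w [ew dw]]] := equivariant_dominated sH HG cM aG du.
  apply: (@le_trans _ _ (critical_value_hom T H rho)).
    by apply: ereal_inf_lbound; exists rho.
  (* An empty level [c'] above [c] is impossible, since [w] stays dominated at [c']. *)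
  apply: ge_ereal_sup => _ [c' /= c'0 <-]; rewrite lee_fin leNgt.
  apply/negP => /ltW cc'; suff : set0 w by [].
  by rewrite -c'0; split=> //; exact: dominated_le dw.
apply: le_ereal_inf_tmp => _ [rho hrho <-].
(* Levels strictly above the supremum are nonempty, and equivariant dominated functions are in
   particular dominated. *)
have le_crit (c : R) : (critical_value_hom T H rho < c%:E)%E ->
    (critical_value H <= c%:E)%E.
  move=> rc; apply: ereal_inf_lbound; exists c => //.
  apply/set0P/eqP => H0; move: rc; rewrite ltNge => /negP; apply.
  by apply: ereal_sup_ubound; exists c => //=; rewrite H0 setI0.
case E : (critical_value_hom T H rho) le_crit => [r||] le_crit.
(* A real supremum is approached from strictly above, where [le_crit] applies. *)
- by apply/lee_addgt0Pr => e e0; apply: le_crit; rewrite lte_fin ltrDl.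
- by rewrite leey.
(* When the supremum is -oo, every real bounds [critical_value H], which leaves only -oo. *)
- case: (critical_value H) le_crit => [r||] // le_crit.
    by have := le_crit (r - 1); rewrite ltNyr lee_fin lerDl oppr_ge0 ler10 => /(_ isT).
  by have := le_crit 0; rewrite ltNyr => /(_ isT).
Qed.
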